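(* Let $X$ be a set with an action of a finite group $G$. Let $A\subset X$ be a subset such that for some integer $r>0$ one has $|A\setminus gA|\le r$ for every $g\in G$. For every subset $S\subset G$ denote $A_S:=\bigcap_{g\in S}gA$, and consider the $G$-invariant subset $$A_0:=\bigcup_{S\subset G,\ |S|>|G|/2}A_S .$$ Then $$|A\setminus A_0|+|A_0\setminus A|\le 2r.$$
   Context: Here $gA=\{ga: a\in A\}$. The sets $X$ and $A$ may be infinite; the inequalities include the assertion that the sets whose cardinalities are bounded are finite. *)

(* Defs.v *)
From mathcomp Require Import all_boot all_fingroup.
From mathcomp Require Import boolp classical_sets cardinality.

Set Implicit Arguments.
Unset Strict Implicit.
Unset Printing Implicit Defensive.

Local Open Scope classical_set_scope.

(* The [action] structure of MathComp encodes right actions; here G acts on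
   the left, so that (g h) A = g (h A). *)
Definition is_left_action (gT : finGroupType) (X : Type) (act : gT -> X -> X) :
    Prop :=
  (forall x, act 1%g x = x) /\
  (forall g h x, act (g * h)%g x = act g (act h x)).

Definition translate (gT : finGroupType) (X : Type) (act : gT -> X -> X)
  (g : gT) (A : set X) : set X := act g @` A.

Definition translates_inter (gT : finGroupType) (X : Type)
  (act : gT -> X -> X) (A : set X) (S : {set gT}) : set X :=
  \bigcap_(g in [set` S]) translate act g A.

Definition majority_core (gT : finGroupType) (X : Type)
  (act : gT -> X -> X) (A : set X) : set X :=
  \bigcup_(S in [set S : {set gT} | #|gT| < 2 * #|S|])
    translates_inter act A S.

(* Main.v *)
Require Import Defs.
From mathcomp Require Import all_boot all_fingroup.
From mathcomp Require Import boolp classical_sets cardinality.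
From mathcomp Require Import finmap zify.

(** Let [n = #|G|] and count pairs [(x, g)].  A point of [A \ A_0] lies in at
    most [n/2] translates of [A], so it lies in [A \ gA] for at least [n/2]
    elements [g]; a point of [A_0 \ A] lies in [gA \ A] for more than [n/2]
    elements [g].  Substituting [x = g y] and [g |-> g^-1], the pairs with
    [x] in [A_0] and in [gA \ A] are equinumerous with those with [x] in [A_0]
    and in [A \ gA], because [A_0] is invariant.  As the latter are disjoint
    from the pairs with [x] in [A \ A_0] and in [A \ gA], altogether there are
    at most [n r] pairs: [(n/2) (|A \ A_0| + |A_0 \ A|) <= n r].  Only the
    finite invariant set of points lying in some [h (A \ gA)] matters. *)

Set Implicit Arguments.
Unset Strict Implicit.
Unset Printing Implicit Defensive.

Local Open Scope classical_set_scope.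
Local Open Scope card_scope.

Lemma card_seq (T : choiceType) (s : seq T) :
  uniq s -> [set` s] #= `I_(size s).
Proof.
move=> us; have -> : [set` s] = [set` [fset x in s]%fset].
  by apply/seteqP; split=> x /=; rewrite !inE.
by apply/card_eq_fsetP; rewrite card_fseq undup_id.
Qed.

(** Turns cardinals into sums of indicators over one fixed list, so that the double counting becomes
    an exchange of finite sums in [nat]. *)
Lemma card_count (T : choiceType) (s : seq T) (D : set T) :
  uniq s -> D `<=` [set` s] -> D #= `I_(\sum_(x <- s) `[< D x >]).
Proof.
move=> us Ds; have -> : D = [set` [seq x <- s | `[< D x >]]].
  apply/seteqP; split=> x /=; rewrite mem_filter.
    by move=> Dx; rewrite (Ds _ Dx) andbT; apply/asboolP.
  by case/andP=> /asboolP.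
rewrite (_ : \sum_(x <- s) _ = size [seq x <- s | `[< D x >]]).
  by apply: card_seq; rewrite filter_uniq.
rewrite size_filter -sum1_count [RHS]big_mkcond /=; apply: eq_bigr => x _.
rewrite (_ : `[< _ >] = `[< D x >]); first by case: asboolP.
apply: asbool_equiv_eq; rewrite /= mem_filter; split=> [/andP[/asboolP]//|Dx].
by rewrite (Ds _ Dx) andbT; apply/asboolP.
Qed.

Section LeftAction.
Variables (gT : finGroupType) (X : Type) (act : gT -> X -> X).
Hypothesis act_left : is_left_action act.

Lemma left_actK g : cancel (act g) (act g^-1%g).
Proof. by case: act_left => a1 aM x; rewrite -aM mulVg a1. Qed.

Lemma left_actKV g : cancel (act g^-1%g) (act g).
Proof. by case: act_left => a1 aM x; rewrite -aM mulgV a1. Qed.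

Lemma translateE g (A : set X) x : translate act g A x <-> A (act g^-1%g x).
Proof.
split=> [[y Ay <-]|Ax]; first by rewrite left_actK.
by exists (act g^-1%g x) => //; rewrite left_actKV.
Qed.

Definition translates_at (A : set X) x : {set gT} :=
  [set g | `[< A (act g^-1%g x) >]]%SET.

(** Among the sets [S] with [x] in [A_S], [translates_at A x] is the largest, so only its size has
    to be tested. *)
Lemma majority_coreE A x :
  majority_core act A x <-> #|gT| < 2 * #|translates_at A x|.
Proof.
split=> [[S /= S_big xS]|x_big].
  apply: leq_trans S_big _; rewrite leq_mul2l subset_leq_card //.
  by apply/fintype.subsetP => g gS; rewrite inE; apply/asboolP/translateE/xS.
exists (translates_at A x) => //= g /=.
by rewrite inE => /asboolP/translateE.
Qed.

(** Left multiplication by [g] maps [translates_at A x] bijectively onto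
    [translates_at A (act g x)]. *)
Lemma card_translates_at_act A g x :
  #|translates_at A (act g x)| = #|translates_at A x|.
Proof.
case: act_left => _ aM.
rewrite -(card_imset (translates_at A x) (@mulgI _ g)).
apply: eq_card => h; rewrite inE; apply/asboolP/imsetP => [Ah|[k + ->]].
  exists (g^-1 * h)%g; last by rewrite mulKVg.
  by rewrite inE invMg invgK aM; apply/asboolP.
by rewrite inE => /asboolP; rewrite invMg aM left_actK.
Qed.

Lemma majority_core_act A g x :
  majority_core act A (act g x) <-> majority_core act A x.
Proof. by rewrite !majority_coreE card_translates_at_act. Qed.

Lemma translate_majority_core A g :
  translate act g (majority_core act A) = majority_core act A.
Proof.
by apply/seteqP; split=> x; rewrite translateE majority_core_act.
Qed.

End LeftAction.

Section Count.
Variables (gT : finGroupType) (X : choiceType) (act : gT -> X -> X).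
Hypothesis act_left : is_left_action act.
Variables (A : set X) (r : nat).
Hypothesis A_close : forall g, (A `\` translate act g A) #<= `I_r.

Let A0 := majority_core act A.

Let moved : set X :=
  \bigcup_(h in [set: gT]) act h @` \bigcup_(g in [set: gT])
    (A `\` translate act g A).

Lemma finite_moved : finite_set moved.
Proof.
apply: bigcup_finite => // h _; apply/finite_image/bigcup_finite => // g _.
by apply/finite_set_leP; exists r.
Qed.

Lemma moved_act g x : moved x -> moved (act g x).
Proof.
case: act_left => _ aM [h _ [y y_moved <-]].
by exists (g * h)%g => //; exists y => //; rewrite aM.
Qed.

Lemma setD_translate_moved g : A `\` translate act g A `<=` moved.
Proof.
case: act_left => a1 _ x xAg.
by exists 1%g => //; exists x => //; exists g.
Qed.

(** A point lying in every translate would lie in the core, since [#|gT| < 2 * #|gT|]; hence some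
    translate misses [x]. *)
Lemma setD_core_moved : A `\` A0 `<=` moved.
Proof.
move=> x [Ax]; rewrite /A0 majority_coreE // => /negP; rewrite -leqNgt => x_small.
have [g xg] : exists g, ~ translate act g A x.
  apply: contrapT => /forallNP xall.
  have: #|gT| <= #|translates_at act A x|.
    rewrite -cardsT subset_leq_card //; apply/fintype.subsetP => g _.
    by rewrite inE; apply/asboolP/(translateE act_left); apply: contrapT; exact: xall.
  have: 0 < #|gT| by apply/card_gt0P; exists 1%g.
  lia.
by apply: (@setD_translate_moved g).
Qed.

(** If [x] lies in [gA] but not in [A], then [g^-1 x] lies in [A] but not in [g^-1 A]; moving it
    back by [g] stays inside [moved]. *)
Lemma core_setD_moved : A0 `\` A `<=` moved.
Proof.
case: (act_left) => a1 _ x []; rewrite /A0 majority_coreE // => x_big Ax.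
have /card_gt0P[g] : 0 < #|translates_at act A x| by lia.
rewrite inE => /asboolP Ag.
rewrite -(left_actKV act_left g x); apply: moved_act.
apply: (@setD_translate_moved g^-1%g); split=> //.
by rewrite translateE // invgK left_actKV.
Qed.

Lemma majority_core_bound : exists m n : nat,
  [/\ (A `\` A0) #= `I_m, (A0 `\` A) #= `I_n & m + n <= 2 * r].
Proof.
have /finite_seqP[s0 Es0] := finite_moved.
pose s := undup s0; have us : uniq s := undup_uniq s0.
have Es : moved = [set` s].
  by rewrite Es0; apply/seteqP; split=> x /=; rewrite mem_undup.
have sP x : x \in s <-> moved x by rewrite Es.
pose a x := `[< A x >]; pose c x := `[< A0 x >].
pose b g x := a (act g^-1%g x).
exists (\sum_(x <- s) `[< (A `\` A0) x >]), (\sum_(x <- s) `[< (A0 `\` A) x >]).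
split.
- by apply: card_count; rewrite // -Es; exact: setD_core_moved.
- by apply: card_count; rewrite // -Es; exact: core_setD_moved.
have DE (P Q : set X) x : `[< (P `\` Q) x >] = `[< P x >] && ~~ `[< Q x >].
  by rewrite -asbool_neg -asbool_and.
have caE g x : c (act g x) = c x.
  by apply: asbool_equiv_eq; exact: majority_core_act.
(* The factor 2 clears the denominator of [n/2]. *)
have pointwise x : #|gT| * ((a x && ~~ c x) + (c x && ~~ a x)) <=
    2 * \sum_(g : gT) ((a x && ~~ c x && ~~ b g x) + (c x && ~~ a x && b g x)).
  have Eb : \sum_(g : gT) (b g x : nat) = #|translates_at act A x|.
    rewrite -sum1_card [RHS]big_mkcond; apply: eq_bigr => g _.
    by rewrite inE /b /a; case: asboolP.
  have EbC : \sum_(g : gT) (b g x : nat) + \sum_(g : gT) (~~ b g x : nat) = #|gT|.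
    rewrite -big_split /= -[RHS]sum1_card; apply: eq_bigr => g _.
    by case: (b g x).
  have Ec : c x = (#|gT| < 2 * #|translates_at act A x|).
    by apply/asboolP/idP; rewrite /A0 majority_coreE.
  rewrite big_split /= -EbC in Ec *; rewrite -Eb in Ec.
  (* With [u] translates containing [x] and [v] missing it, [c x] says [u + v < 2 * u]. The claim is
     [u + v <= 2 * v] on [A] minus [A0], [u + v <= 2 * u] on [A0] minus [A], and trivial
     elsewhere. *)
  case: (a x) Ec; case: (c x) => /= /esym; rewrite ?big1_eq;
    set u := \sum_g (b g x : nat); set v := \sum_g (~~ b g x : nat); lia.
have swap : \sum_(x <- s) \sum_(g : gT) (c x && ~~ a x && b g x : nat) =
            \sum_(x <- s) \sum_(g : gT) (c x && a x && ~~ b g x : nat).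
  rewrite exchange_big [RHS]exchange_big /= (reindex_inj invg_inj) /=.
  apply: eq_bigr => g _.
  (* The substitution only permutes the list because [moved] is invariant, which is the purpose of
     the outer union over [h] in its definition. *)
  have s_act : perm_eq s (map (act g^-1%g) s).
    apply: uniq_perm => //.
      by rewrite map_inj_uniq //; apply: can_inj (left_actK act_left _).
    move=> x; apply/idP/mapP => [/sP xs|[y /sP ys ->]]; last exact/sP/moved_act.
    by exists (act g x); [exact/sP/moved_act | rewrite left_actK].
  rewrite (perm_big _ s_act) big_map; apply: eq_bigr => x _.
  by rewrite caE /b invgK left_actKV // andbAC.
have close g : \sum_(x <- s) (a x && ~~ b g x : nat) <= r.
  have -> : \sum_(x <- s) (a x && ~~ b g x : nat) =
            \sum_(x <- s) `[< (A `\` translate act g A) x >].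
    apply: eq_bigr => x _; rewrite DE; congr (nat_of_bool (_ && ~~ _)).
    by apply: asbool_equiv_eq; rewrite translateE.
  rewrite -card_le_II -(card_le_eql (card_count us _)) // -Es.
  exact: setD_translate_moved.
have total : \sum_(x <- s) \sum_(g : gT)
    ((a x && ~~ c x && ~~ b g x) + (c x && ~~ a x && b g x)) <= #|gT| * r.
  under eq_bigr do rewrite big_split /=.
  rewrite big_split /= swap -big_split /=.
  under eq_bigr do rewrite -big_split /=.
  rewrite exchange_big /= -sum_nat_const; apply: leq_sum => g _.
  (* Both summands now count points of [A] outside [gA], one off [A0] and the other in [A0], so they
     never hold together. *)
  apply: leq_trans (close g); apply: leq_sum => y _.
  by case: (a y); case: (c y); case: (b g y).
have gT_gt0 : 0 < #|gT| by apply/card_gt0P; exists 1%g.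
rewrite -(leq_pmul2l gT_gt0) -big_split mulnCA big_distrr /=.
apply: leq_trans (leq_mul (leqnn 2) total); rewrite big_distrr /=.
by apply: leq_sum => x _; rewrite !DE; exact: pointwise.
Qed.

End Count.

Theorem theorem3p1 (gT : finGroupType) (X : Type) (act : gT -> X -> X)
  (act_left : is_left_action act) (A : set X) (r : nat) (r_gt0 : 0 < r)
  (A_close : forall g : gT, (A `\` translate act g A) #<= `I_r) :
  let A0 := majority_core act A in
  (forall g : gT, translate act g A0 = A0) /\
  (exists m n : nat,
     [/\ (A `\` A0) #= `I_m, (A0 `\` A) #= `I_n & m + n <= 2 * r]).
Proof.
split=> [g|]; first exact: translate_majority_core.
(* Sums over lists of points need a choice structure, which [{classic X}] puts on the arbitrary type
   [X]. *)
exact: (@majority_core_bound gT {classic X} act act_left A r A_close).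
Qed.
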